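(* Let $A=(a_{i,j})_{1\le i,j\le 3}$ be a $3\times 3$ matrix. Then for all integers $m\ge 1$, $$\left(a_{1,2} a_{2,1} a_{2,3}-a_{1,3} a_{2,1} a_{2,2}+a_{1,3} a_{2,1} a_{3,3}-a_{1,3} a_{2,3} a_{3,1}\right) \cdot (A^m)_{12}$$ $$+\left(a_{1,2} a_{2,3} a_{3,1}-a_{1,3} a_{2,1} a_{3,2}\right) \cdot (A^m)_{13}$$ $$+\left(-a_{1,2}^{2} a_{2,3}+a_{1,2} a_{1,3} a_{2,2}-a_{1,2} a_{1,3} a_{3,3}+a_{1,3}^{2} a_{3,2}\right) \cdot (A^m)_{21} = 0 .$$
   Context: For a matrix $B$, $B_{ij}$ denotes its $(i,j)$ entry. The entries of $A$ are commuting quantities (e.g. elements of a field or indeterminates). *)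

(* Defs.v *)
From mathcomp Require Import all_boot all_order all_algebra.

Set Implicit Arguments.
Unset Strict Implicit.
Unset Printing Implicit Defensive.

(* Rows and columns of a 3 x 3 matrix are numbered 1, 2, 3, while 'I_3 is
   0-based. *)
Definition i1 : 'I_3 := @Ordinal 3 0 isT.
Definition i2 : 'I_3 := @Ordinal 3 1 isT.
Definition i3 : 'I_3 := @Ordinal 3 2 isT.

(* Main.v *)
(** The identity holds with any matrix [B] commuting with [A] in place of
    [A ^+ m]: it is a linear combination, with coefficients quadratic in [A],
    of the entries of [A *m B = B *m A], so neither Cayley-Hamilton nor an
    induction on [m] is needed. *)
Require Import Defs.
From mathcomp Require Import all_boot all_order all_algebra.
From mathcomp Require Import ring.
Import GRing.Theory.
Local Open Scope ring_scope.

(** Writes entries of products with the named indices, so that [ring] sees polynomials in the matrix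
    entries. *)
Lemma mulmx3E (R : pzSemiRingType) (A B : 'M[R]_3) (i j : 'I_3) :
  (A *m B) i j = A i i1 * B i1 j + A i i2 * B i2 j + A i i3 * B i3 j.
Proof.
rewrite mxE !big_ord_recl big_ord0 addr0 addrA.
(* The [lift]s produced by [big_ord_recl] are matched with [i1], [i2], [i3] through their underlying
   naturals. *)
by congr (A i _ * B _ j + A i _ * B _ j + A i _ * B _ j); apply: val_inj.
Qed.

Lemma comm_mx3_identity (R : comPzRingType) (A B : 'M[R]_3) :
  comm_mx A B ->
  (A i1 i2 * A i2 i1 * A i2 i3 - A i1 i3 * A i2 i1 * A i2 i2
     + A i1 i3 * A i2 i1 * A i3 i3 - A i1 i3 * A i2 i3 * A i3 i1) * B i1 i2
  + (A i1 i2 * A i2 i3 * A i3 i1 - A i1 i3 * A i2 i1 * A i3 i2) * B i1 i3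
  + (- A i1 i2 ^+ 2 * A i2 i3 + A i1 i2 * A i1 i3 * A i2 i2
     - A i1 i2 * A i1 i3 * A i3 i3 + A i1 i3 ^+ 2 * A i3 i2) * B i2 i1 = 0.
Proof.
move=> AB.
pose E i j := (A *m B) i j - (B *m A) i j.
have E0 i j : E i j = 0 by rewrite /E AB subrr.
(* The coefficients were found by solving a linear system for the unknown
   quadratic multipliers of the commutator entries [E i j]. *)
transitivity ((A i1 i3 * (A i1 i1 - A i3 i3) - A i1 i2 * A i2 i3) * E i1 i1
  + A i1 i3 * (A i2 i1 * E i1 i2 + A i3 i1 * E i1 i3
               + A i1 i2 * E i2 i1 + A i1 i3 * E i3 i1)).
  (* A polynomial identity in the 18 entries of [A] and [B], taken as independent; commutation
     enters only through [E0]. *)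
  by rewrite /E !mulmx3E; ring.
by rewrite !E0 !(mulr0, addr0).
Qed.

Theorem mainTheorem3 (R : comPzRingType) (A : 'M[R]_3) (m : nat)
    (hm : (1 <= m)%N) :
  (A i1 i2 * A i2 i1 * A i2 i3 - A i1 i3 * A i2 i1 * A i2 i2
     + A i1 i3 * A i2 i1 * A i3 i3 - A i1 i3 * A i2 i3 * A i3 i1)
    * (A ^+ m) i1 i2
  + (A i1 i2 * A i2 i3 * A i3 i1 - A i1 i3 * A i2 i1 * A i3 i2)
    * (A ^+ m) i1 i3
  + (- A i1 i2 ^+ 2 * A i2 i3 + A i1 i2 * A i1 i3 * A i2 i2
     - A i1 i2 * A i1 i3 * A i3 i3 + A i1 i3 ^+ 2 * A i3 i2)
    * (A ^+ m) i2 i1 = 0.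
(* Ring multiplication on ['M[R]_3] is [*m], so [GRing.comm] serves as [comm_mx]. *)
Proof. exact/comm_mx3_identity/commrX. Qed.
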